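(* Let $\mathcal Q$ be the polar space of a non-degenerate quadratic form $q$ of finite Witt index $n\ge2$ and anisotropic defect $d>0$ (possibly infinite) over a field $\mathbb F$. If $\mathrm{char}(\mathbb F)=2$ assume moreover that the elliptic sub-defect $d_2$ of $q$ is positive. Then $\mathrm{gr}(\mathcal Q_n)\le 2^n$.
   Context: $q:V\to\mathbb F$ is a quadratic form with bilinearization $f(x,y)=q(x+y)-q(x)-q(y)$; non-degenerate means $q(v)\ne0$ for every nonzero $v$ in the radical of $f$. With finite Witt index $n$, $V=V_1\oplus\cdots\oplus V_n\oplus V_0$ where $V_i$ are pairwise orthogonal hyperbolic planes and $V_0$ is orthogonal to them with $q|_{V_0}$ anisotropic ($q(v)\ne0$ for $v\in V_0\setminus\{0\}$); $d=\dim V_0$. When $\mathrm{char}\,\mathbb F=2$, the radical $R$ of $f$ lies in $V_0$ and $d_2$ is the codimension of $R$ in $V_0$. $\mathcal Q$ has as points the 1-spaces $\langle v\rangle$ with $q(v)=0$; $S_k(\mathcal Q)$ is the set of totally singular subspaces of dimension $k$. The dual polar space $\mathcal Q_n$ has points $S_n(\mathcal Q)$ and lines $\{Z\in S_n(\mathcal Q):Z\supset X\}$, $X\in S_{n-1}(\mathcal Q)$. $\mathrm{gr}$ is the minimum size of a set of points whose span (smallest set of points closed under lines meeting it in $\ge2$ points) is all points. *)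

(* Defs.v *)
From HB Require Import structures.
From mathcomp Require Import all_boot all_order all_algebra.
Set Implicit Arguments.
Unset Strict Implicit.
Unset Printing Implicit Defensive.
Import GRing.Theory.
Local Open Scope ring_scope.

Section QuadraticForms.
Variables (F : fieldType) (V : lmodType F).

Definition qf_polar (q : V -> F) (x y : V) : F := q (x + y) - q x - q y.

(* q is a quadratic form: homogeneous of degree 2 with bilinear polarization
   (qf_polar is symmetric by definition, so linearity in the first argument
   gives bilinearity) *)
Definition is_quadratic_form (q : V -> F) : Prop :=
  (forall (a : F) (v : V), q (a *: v) = a ^+ 2 * q v) /\
  (forall (a : F) (x y z : V),
      qf_polar q (a *: x + y) z = a * qf_polar q x z + qf_polar q y z).

Definition qf_radical (q : V -> F) (v : V) : Prop := forall w, qf_polar q v w = 0.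

Definition qf_nondegenerate (q : V -> F) : Prop :=
  forall v, qf_radical q v -> v <> 0 -> q v <> 0.

Definition qf_span_of (k : nat) (v : 'I_k -> V) : V -> Prop :=
  fun x => exists c : 'I_k -> F, x = \sum_(i < k) c i *: v i.

Definition qf_lin_indep (k : nat) (v : 'I_k -> V) : Prop :=
  forall c : 'I_k -> F, \sum_(i < k) c i *: v i = 0 -> forall i, c i = 0.

Definition subspace_of_dim (k : nat) (W : V -> Prop) : Prop :=
  exists v : 'I_k -> V, qf_lin_indep v /\ forall x, W x <-> qf_span_of v x.

Definition qf_totally_singular (q : V -> F) (W : V -> Prop) : Prop :=
  forall x, W x -> q x = 0.

Definition TS (q : V -> F) (k : nat) (W : V -> Prop) : Prop :=
  subspace_of_dim k W /\ qf_totally_singular q W.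

(* the line of the dual qf_polar space Q_n determined by X in S_{n-1}:
   Z lies on it iff Z in S_n and Z contains X *)
Definition dpline (q : V -> F) (n : nat) (X Z : V -> Prop) : Prop :=
  TS q n Z /\ (forall x, X x -> Z x).

Definition dp_closed (q : V -> F) (n : nat) (T : (V -> Prop) -> Prop) : Prop :=
  forall X, TS q n.-1 X ->
  forall Z1 Z2, dpline q n X Z1 -> dpline q n X Z2 -> Z1 <> Z2 ->
  T Z1 -> T Z2 -> forall Z, dpline q n X Z -> T Z.

Definition dp_generates (q : V -> F) (n : nat) (P : (V -> Prop) -> Prop) : Prop :=
  forall T, (forall Z, P Z -> T Z) -> dp_closed q n T ->
  forall Z, TS q n Z -> T Z.

Definition hyperbolic_family (q : V -> F) (n : nat) (e f : 'I_n -> V) : Prop :=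
  (forall i, q (e i) = 0 /\ q (f i) = 0) /\
  (forall i j, qf_polar q (e i) (e j) = 0 /\ qf_polar q (f i) (f j) = 0 /\
               qf_polar q (e i) (f j) = (i == j)%:R).

Definition defect_space (q : V -> F) (n : nat) (e f : 'I_n -> V) : V -> Prop :=
  fun v => forall i, qf_polar q v (e i) = 0 /\ qf_polar q v (f i) = 0.

End QuadraticForms.

(* Main.v *)
Require Import Defs.
From HB Require Import structures.
From mathcomp Require Import all_boot all_order all_algebra.
From mathcomp Require Import ring zify.
From Stdlib Require Import Classical FunctionalExtensionality PropExtensionality.
(** Call a singular point good (for a closed set [T], in the residue of a totally
    singular [U]) when every maximal totally singular subspace through it and [U] is
    in [T]. If two opposite points [p], [p'] are good, all are: by induction on the
    rank of the residue, every singular point orthogonal to [p] and [p'] is good, and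
    in rank at least 3 each maximal subspace contains such a point. In rank 1 the
    residue is a line. In rank 2 a maximal subspace missing [{p, p'}^perp] contains
    a point [r] collinear with two distinct good points; this is the step that needs
    vectors of the anisotropic part which are not in the radical. Applied along a
    flag, this shows that the [2 ^ n] subspaces of the apartment of the hyperbolic
    basis generate. *)

Set Implicit Arguments.
Unset Strict Implicit.
Unset Printing Implicit Defensive.
Import GRing.Theory.
Local Open Scope ring_scope.

(** * Linear algebra of subspaces given as predicates *)

Section Subspaces.
Variables (F : fieldType) (V : lmodType F).
Implicit Types (U W : V -> Prop) (x y z : V).

Definition adjoin U x : V -> Prop := fun y => exists a : F, U (y - a *: x).

(** A closed set [T] is an arbitrary property of predicates, so membership in it transfers only
    along Leibniz equality. *)
Lemma pred_ext U W : (forall x, U x <-> W x) -> U = W.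
Proof.
move=> h; apply: functional_extensionality => x.
exact: propositional_extensionality.
Qed.

Lemma subspace0 k U : subspace_of_dim k U -> U 0.
Proof.
move=> [u [_ hu]]; apply/hu; exists (fun=> 0).
by rewrite big1 // => i _; rewrite scale0r.
Qed.

Lemma subspaceD k U x y : subspace_of_dim k U -> U x -> U y -> U (x + y).
Proof.
move=> [u [_ hu]] /hu[c ->] /hu[d ->]; apply/hu; exists (fun i => c i + d i).
by rewrite -big_split; apply: eq_bigr => i _; rewrite scalerDl.
Qed.

Lemma subspaceZ k U a x : subspace_of_dim k U -> U x -> U (a *: x).
Proof.
move=> [u [_ hu]] /hu[c ->]; apply/hu; exists (fun i => a * c i).
by rewrite scaler_sumr; apply: eq_bigr => i _; rewrite scalerA.
Qed.

Lemma subspaceB k U x y : subspace_of_dim k U -> U x -> U y -> U (x - y).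
Proof.
by move=> hU Ux Uy; rewrite -scaleN1r; apply: (subspaceD hU) => //;
   apply: (subspaceZ _ hU).
Qed.

Lemma subspace_sum k U m (c : 'I_m -> F) (v : 'I_m -> V) :
  subspace_of_dim k U -> (forall i, U (v i)) -> U (\sum_(i < m) c i *: v i).
Proof.
move=> hU Uv; apply: (big_ind U); first exact: (subspace0 hU).
- by move=> x y; apply: (subspaceD hU).
- by move=> i _; apply: (subspaceZ _ hU).
Qed.

Lemma subspaceZ_inv k U a x :
  subspace_of_dim k U -> a != 0 -> U (a *: x) -> U x.
Proof.
move=> hU a0 Ux; rewrite -[x](scalerK a0); exact: (subspaceZ _ hU).
Qed.

Lemma span_subspace k (u : 'I_k -> V) :
  qf_lin_indep u -> subspace_of_dim k (qf_span_of u).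
Proof. by exists u. Qed.

Lemma mem_span k (u : 'I_k -> V) i : qf_span_of u (u i).
Proof.
exists (fun j => (j == i)%:R); rewrite (bigD1 i) //= eqxx scale1r big1 ?addr0 //.
by move=> j /negPf ->; rewrite scale0r.
Qed.

Lemma adjoin_sub U x y : U y -> adjoin U x y.
Proof. by exists 0; rewrite scale0r subr0. Qed.

Lemma adjoin_mem k U x : subspace_of_dim k U -> adjoin U x x.
Proof. by move=> hU; exists 1; rewrite scale1r subrr; apply: (subspace0 hU). Qed.

Lemma adjoin_le k U W x : subspace_of_dim k W ->
  (forall y, U y -> W y) -> W x -> forall y, adjoin U x y -> W y.
Proof.
move=> hW UW Wx y [a /UW Wy]; rewrite -(subrK (a *: x) y).
exact: (subspaceD hW Wy (subspaceZ _ hW Wx)).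
Qed.

Lemma adjoin_dim k U x :
  subspace_of_dim k U -> ~ U x -> subspace_of_dim k.+1 (adjoin U x).
Proof.
move=> hU; have [u [indu hu]] := hU; move=> Ux.
pose u' i := if unlift ord0 i is Some j then u j else x.
have u'E (c : 'I_k.+1 -> F) : \sum_(i < k.+1) c i *: u' i =
   c ord0 *: x + \sum_(i < k) c (lift ord0 i) *: u i.
  rewrite big_ord_recl /u' unlift_none; congr (_ + _).
  by apply: eq_bigr => i _; rewrite liftK.
exists u'; split=> [c|y]; last first.
  split=> [[a /hu[c hc]]|[c ->]].
    exists (fun i => if unlift ord0 i is Some j then c j else a).
    rewrite u'E unlift_none -(subrK (a *: x) y) hc addrC; congr (_ + _).
    by apply: eq_bigr => i _; rewrite liftK.
  exists (c ord0); rewrite u'E addrAC subrr add0r.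
  by apply/hu; exists (fun i => c (lift ord0 i)).
rewrite u'E => h.
have c0 : c ord0 = 0.
  apply/eqP; apply/negP => /negP c0; apply: Ux; apply: (subspaceZ_inv hU c0).
  apply/hu; exists (fun i => - c (lift ord0 i)).
  move/eqP: h; rewrite addr_eq0 => /eqP ->; rewrite -sumrN.
  by apply: eq_bigr => i _; rewrite scaleNr.
move: h; rewrite c0 scale0r add0r => /indu h i.
by case: (unliftP ord0 i) => [j|] ->.
Qed.

Lemma kermx_nz m k (A : 'M[F]_(m, k)) :
  (k < m)%N -> exists2 c : 'rV_m, c != 0 & c *m A = 0.
Proof.
move=> km; have : kermx A != 0.
  by rewrite kermx_eq0 /row_free; have := rank_leq_col A; lia.
move=> /rowV0Pn [c ck c0]; exists c => //; exact/sub_kermxP.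
Qed.

(** Otherwise the coefficient matrix of [u] in terms of [w] has more rows than columns, and a
    nonzero vector of its left kernel is a linear relation between the [u i]. *)
Lemma subspace_dim_le k m U W : subspace_of_dim k U -> subspace_of_dim m W ->
  (forall x, U x -> W x) -> (k <= m)%N.
Proof.
move=> [u [indu hu]] [w [_ hw]] UW; rewrite leqNgt; apply/negP => mk.
have /fin_all_exists[M hM] : forall i, exists c : 'I_m -> F,
    u i = \sum_(j < m) c j *: w j.
  by move=> i; apply/hw/UW/hu/mem_span.
have [c c0 cM] := kermx_nz (\matrix_(i, j) M i j) mk.
case/negP: c0; apply/eqP/rowP => i; rewrite mxE; apply: (indu (c 0)).
under eq_bigr do rewrite hM scaler_sumr.
rewrite exchange_big big1 //= => j _.
under eq_bigr do rewrite scalerA.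
rewrite -scaler_suml; have /rowP/(_ j) := cM; rewrite !mxE.
by under eq_bigr do rewrite mxE; move=> ->; rewrite scale0r.
Qed.

Lemma subspace_extra k m U W : subspace_of_dim k U -> subspace_of_dim m W ->
  (k < m)%N -> exists2 z, W z & ~ U z.
Proof.
move=> hU hW km; apply: NNPP => h.
have : (m <= k)%N.
  apply: (subspace_dim_le hW hU) => x Wx; apply: NNPP => Ux; apply: h.
  by exists x.
lia.
Qed.

Lemma subspace_eq k U W : subspace_of_dim k U -> subspace_of_dim k W ->
  (forall x, U x -> W x) -> U = W.
Proof.
move=> hU hW UW; apply: pred_ext => x; split=> [/UW //|Wx].
apply: NNPP => Ux; have := subspace_dim_le (adjoin_dim hU Ux) hW.
by move/(_ (adjoin_le hW UW Wx)); rewrite ltnn.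
Qed.

End Subspaces.

(** * Polar form and orthogonality *)

Section Quadratic.
Variables (F : fieldType) (V : lmodType F) (q : V -> F).
Hypothesis qP : is_quadratic_form q.
Implicit Types (U W : V -> Prop) (x y z : V).
Local Notation B := (qf_polar q).

Definition perp U x := forall u, U u -> B u x = 0.

Lemma polarC x y : B x y = B y x.
Proof. by rewrite /qf_polar [y + x]addrC addrAC. Qed.

Lemma polarDl x y z : B (x + y) z = B x z + B y z.
Proof. by have := qP.2 1 x y z; rewrite scale1r mul1r. Qed.

Lemma polar0l z : B 0 z = 0.
Proof. by apply: (addrI (B 0 z)); rewrite -polarDl !addr0. Qed.

Lemma polarZl a x z : B (a *: x) z = a * B x z.
Proof. by have := qP.2 a x 0 z; rewrite addr0 polar0l addr0. Qed.

Lemma polarNl x z : B (- x) z = - B x z.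
Proof. by rewrite -scaleN1r polarZl mulN1r. Qed.

Lemma polarDr x y z : B z (x + y) = B z x + B z y.
Proof. by rewrite polarC polarDl !(polarC z). Qed.

Lemma polarZr a x z : B z (a *: x) = a * B z x.
Proof. by rewrite polarC polarZl (polarC z). Qed.

Lemma polarNr x z : B z (- x) = - B z x.
Proof. by rewrite polarC polarNl (polarC z). Qed.

Lemma polar_suml k (c : 'I_k -> F) (v : 'I_k -> V) z :
  B (\sum_(i < k) c i *: v i) z = \sum_(i < k) c i * B (v i) z.
Proof.
rewrite (big_morph (B^~ z) (fun x y => polarDl x y z) (polar0l z)).
by apply: eq_bigr => i _; rewrite polarZl.
Qed.

Lemma polar_sumr k (c : 'I_k -> F) (v : 'I_k -> V) z :
  B z (\sum_(i < k) c i *: v i) = \sum_(i < k) c i * B z (v i).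
Proof. by rewrite polarC polar_suml; under eq_bigr do rewrite polarC. Qed.

Definition polarE :=
  (polarDl, polarDr, polarZl, polarZr, polarNl, polarNr).

Lemma qfD x y : q (x + y) = q x + q y + B x y.
Proof. by rewrite /qf_polar; ring. Qed.

Lemma qfZ a x : q (a *: x) = a ^+ 2 * q x.
Proof. exact: qP.1. Qed.

Lemma qfN x : q (- x) = q x.
Proof. by rewrite -scaleN1r qfZ; ring. Qed.

Lemma qf0 : q 0 = 0.
Proof. by rewrite -(scale0r 0) qfZ; ring. Qed.

Lemma polarxx x : B x x = 2%:R * q x.
Proof.
rewrite /qf_polar -[x in q (x + _)]scale1r -[x in q (_ + x)]scale1r.
by rewrite -scalerDl qfZ; ring.
Qed.

Lemma polarxx0 x : q x = 0 -> B x x = 0.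
Proof. by rewrite polarxx => ->; rewrite mulr0. Qed.

Lemma TS_polar k U x y : TS q k U -> U x -> U y -> B x y = 0.
Proof.
move=> [hU sU] Ux Uy; rewrite /qf_polar !sU ?subr0 //.
exact: (subspaceD hU).
Qed.

Lemma perpD U x y : perp U x -> perp U y -> perp U (x + y).
Proof. by move=> hx hy u Uu; rewrite polarDr hx // hy // addr0. Qed.

Lemma perp_scale U a x : perp U x -> perp U (a *: x).
Proof. by move=> hx u Uu; rewrite polarZr hx // mulr0. Qed.

Lemma perpN U x : perp U x -> perp U (- x).
Proof. by move=> hx u Uu; rewrite polarNr hx // oppr0. Qed.

Lemma perp_adjoin U x y : perp U y -> B x y = 0 -> perp (adjoin U x) y.
Proof.
move=> hy xy u [a /hy]; rewrite !polarE xy mulr0 subr0; exact.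
Qed.

Lemma perp_notin U x y : perp U y -> B x y <> 0 -> ~ U x.
Proof. by move=> hy xy /hy. Qed.

Lemma adjoin_TS k U x :
  TS q k U -> ~ U x -> q x = 0 -> perp U x -> TS q k.+1 (adjoin U x).
Proof.
move=> [hU sU] Ux qx px; split; first exact: adjoin_dim.
move=> y [a hy]; rewrite -(subrK (a *: x) y) qfD sU // qfZ qx.
by rewrite polarZr px // !mulr0 !addr0.
Qed.

(** The vectors of [W] orthogonal to all [p i] form the left kernel of an [m] by [r] matrix, of
    dimension at least [m - r > k], so they cannot all lie in [U]. *)
Lemma subspace_extra_perp k m U W r (p : 'I_r -> V) :
  subspace_of_dim k U -> subspace_of_dim m W -> (k + r < m)%N ->
  exists z, [/\ W z, ~ U z & forall i, B z (p i) = 0].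
Proof.
move=> hU hW krm; have [w [indw hw]] := hW.
pose A := \matrix_(i < m, j < r) B (w i) (p j); pose K := row_base (kermx A).
pose v i := \sum_(j < m) K i j *: w j.
have KA : K *m A = 0 by apply/sub_kermxP; rewrite eq_row_base.
have indv : qf_lin_indep v.
  move=> c; rewrite /v; under eq_bigr do rewrite scaler_sumr.
  rewrite exchange_big /=; under eq_bigr do under eq_bigr do rewrite scalerA.
  under eq_bigr do rewrite -scaler_suml.
  move=> /indw h i; have /rowP/(_ i) : \row_i c i = 0; last by rewrite !mxE.
  apply: (row_free_inj (row_base_free (kermx A))).
  rewrite mul0mx; apply/rowP => j; rewrite mxE [RHS]mxE -[RHS](h j).
  by apply: eq_bigr => l _; rewrite mxE.
have Wv i : W (v i) by apply: (subspace_sum _ hW) => j; apply/hw/mem_span.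
have pv j i : B (v i) (p j) = 0.
  have KAij : (K *m A) i j = 0 by rewrite KA mxE.
  rewrite polar_suml -[RHS]KAij [RHS]mxE.
  by apply: eq_bigr => l _; rewrite [A _ _]mxE.
have hv := span_subspace indv.
have [|z [c ->] Uz] := subspace_extra hU hv.
  by rewrite mxrank_ker; have := rank_leq_col A; lia.
exists (\sum_i c i *: v i); split=> // [|j].
  exact: (subspace_sum _ hW).
by rewrite polar_suml big1 // => i _; rewrite pv mulr0.
Qed.

Lemma qf_sum_singular k (c : 'I_k -> F) (v : 'I_k -> V) :
  (forall i, q (v i) = 0) -> (forall i j, B (v i) (v j) = 0) ->
  q (\sum_(i < k) c i *: v i) = 0.
Proof.
move=> qv Bv.
have [] : q (\sum_(i < k) c i *: v i) = 0 /\
          forall j, B (\sum_(i < k) c i *: v i) (v j) = 0; last by [].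
apply: (big_rec (fun x => q x = 0 /\ forall j, B x (v j) = 0)).
  by split=> [|j]; rewrite ?qf0 ?polar0l.
move=> i x _ [qx xv]; split=> [|j].
  by rewrite qfD qfZ qv qx polarC polarZr xv !mulr0 !addr0.
by rewrite polarDl polarZl Bv xv mulr0 addr0.
Qed.

(** * The hyperbolic basis and maximal totally singular subspaces *)

Section Hyperbolic.
Variables (n : nat) (e f : 'I_n -> V).
Hypothesis efP : hyperbolic_family q e f.
Hypothesis aniso : forall v, defect_space q e f v -> v <> 0 -> q v <> 0.

Let polar_ee i j : B (e i) (e j) = 0. Proof. by case: (efP.2 i j). Qed.
Let polar_ff i j : B (f i) (f j) = 0. Proof. by case: (efP.2 i j) => _ []. Qed.
Let polar_ef i j : B (e i) (f j) = (i == j)%:R.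
Proof. by case: (efP.2 i j) => _ []. Qed.
Let polar_fe i j : B (f i) (e j) = (i == j)%:R.
Proof. by rewrite polarC polar_ef eq_sym. Qed.

Lemma sum_delta (c : 'I_n -> F) i : \sum_(j < n) c j * (j == i)%:R = c i.
Proof.
rewrite (bigD1 i) //= eqxx mulr1 big1 ?addr0 // => j /negPf ->.
by rewrite mulr0.
Qed.

(* [y - \sum_j B y (f j) *: e j] lies in the defect space, where [q] is anisotropic. *)
Lemma singular_perp_e y : q y = 0 -> (forall i, B y (e i) = 0) ->
  y = \sum_(j < n) B y (f j) *: e j.
Proof.
move=> qy ye; set z := \sum_(j < n) _.
have ze i : B z (e i) = 0.
  by rewrite polar_suml big1 // => j _; rewrite polar_ee mulr0.
have zf i : B z (f i) = B y (f i).
  by rewrite polar_suml; under eq_bigr do rewrite polar_ef; rewrite sum_delta.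
have qz : q z = 0 by apply: qf_sum_singular => [i|i j]; rewrite ?(efP.1 i).1.
have yz : B y z = 0.
  by rewrite polar_sumr big1 // => j _; rewrite ye mulr0.
apply: NNPP => yz_neq; apply: (aniso (v := y - z)).
- by move=> i; rewrite !polarE ye ze zf !subrr.
- by move/eqP; rewrite subr_eq0 => /eqP.
- by rewrite qfD qfN qy qz polarNr yz oppr0 !addr0.
Qed.

(** The vectors of [Y] orthogonal to every [e j] are combinations of the [e j], with coordinates
    [K *m G] of the same rank as [K]. They are orthogonal to [Y], so [K *m G *m E^T = 0] and
    [\rank K + \rank E <= n], where the left side is [m]. *)
Lemma witt_index_le m Y : TS q m Y -> (m <= n)%N.
Proof.
move=> [[y [indy hY]] sY]; rewrite leqNgt; apply/negP => nm.
have yTS : TS q m Y by split=> //; exists y.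
pose E := \matrix_(i < m, j < n) B (y i) (e j).
pose G := \matrix_(i < m, j < n) B (y i) (f j).
pose K := kermx E.
pose vec (c : 'rV[F]_m) := \sum_(i < m) c 0 i *: y i.
have vecY c : Y (vec c) by apply/hY; exists (c 0).
have vec_e (c : 'rV_m) j : B (vec c) (e j) = (c *m E) 0 j.
  by rewrite polar_suml mxE; apply: eq_bigr => i _; rewrite mxE.
have vec_f (c : 'rV_m) j : B (vec c) (f j) = (c *m G) 0 j.
  by rewrite polar_suml mxE; apply: eq_bigr => i _; rewrite mxE.
have vecE (c : 'rV_m) : c *m E = 0 -> vec c = \sum_(j < n) (c *m G) 0 j *: e j.
  move=> cE; rewrite [LHS]singular_perp_e ?sY //.
    by apply: eq_bigr => j _; rewrite vec_f.
  by move=> i; rewrite vec_e cE mxE.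
have KG : \rank (K *m G) = \rank K.
  apply/mxrank_injP/rowV0P => c.
  rewrite sub_capmx => /andP[/sub_kermxP cE /sub_kermxP cG].
  apply/rowP => i; rewrite mxE; apply: (indy (c 0)); rewrite -/(vec c) vecE // cG.
  by rewrite big1 // => j _; rewrite mxE scale0r.
have /mulmx0_rank_max : K *m G *m E^T = 0.
  apply/row_matrixP => i; rewrite row_mul row_mul row0.
  have cE : row i K *m E = 0 by rewrite -row_mul mulmx_ker row0.
  apply/rowP => j; rewrite !mxE -[RHS](TS_polar yTS (vecY (row i K)) (_ : Y (y j))).
    rewrite vecE // polar_suml; apply: eq_bigr => l _; rewrite !mxE.
    by congr (_ * _); exact: polarC.
  by apply/hY/mem_span.
rewrite KG mxrank_tr mxrank_ker; have := rank_leq_col E; lia.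
Qed.

(* A maximal totally singular [Z] cuts the hyperbolic space [H] in a Lagrangian [L]
   and is in duality with [H / L]. If the polar form vanished on [Z^perp], correcting
   [v] by some [h] in [H] would put [v + h] in [Z^perp]; then [h] is orthogonal to [L],
   so [h] lies in [L] and [v] itself in [Z^perp]. *)
Lemma polar_nonzero_on_perp Z v : TS q n Z -> defect_space q e f v ->
  ~ qf_radical q v -> exists x y, [/\ perp Z x, perp Z y & B x y <> 0].
Proof.
move=> ZTS vD vR; have [[z [indz hZ]] sZ] := ZTS.
apply: NNPP => nxy.
have B0 x y : perp Z x -> perp Z y -> B x y = 0.
  by move=> hx hy; apply: NNPP => xy; apply: nxy; exists x, y.
pose h (i : 'I_(n + n)) := match split i with inl j => e j | inr j => f j end.
pose vec (c : 'rV[F]_(n + n)) := \sum_i c 0 i *: h i.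
pose C := \matrix_(i < n + n, j < n) B (h i) (z j).
pose G := \matrix_(i < n + n, j < n + n) B (h i) (h j).
have GE : G = block_mx 0 1%:M 1%:M 0.
  apply/matrixP => i j; rewrite mxE /h.
  case: (splitP i) => i' Ei; case: (splitP j) => j' Ej.
  - have -> : i = lshift n i' by apply: val_inj.
    have -> : j = lshift n j' by apply: val_inj.
    by rewrite block_mxEul mxE.
  - have -> : i = lshift n i' by apply: val_inj.
    have -> : j = rshift n j' by apply: val_inj.
    by rewrite block_mxEur mxE.
  - have -> : i = rshift n i' by apply: val_inj.
    have -> : j = lshift n j' by apply: val_inj.
    by rewrite block_mxEdl mxE.
  - have -> : i = rshift n i' by apply: val_inj.
    have -> : j = rshift n j' by apply: val_inj.
    by rewrite block_mxEdr mxE.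
have Gu : G \in unitmx.
  have /mulmx1_unit[] // : G *m G = 1%:M.
  by rewrite GE mulmx_block !mul0mx !mul1mx !addr0 !add0r -scalar_mx_block.
have vec_z (c : 'rV_(n + n)) j : B (vec c) (z j) = (c *m C) 0 j.
  by rewrite polar_suml mxE; apply: eq_bigr => i _; rewrite mxE.
have vec_vec (c d : 'rV_(n + n)) : B (vec c) (vec d) = (c *m G *m d^T) 0 0.
  rewrite polar_sumr mxE; apply: eq_bigr => i _; rewrite polar_suml !mxE mulrC.
  by congr (_ * _); apply: eq_bigr => j _; rewrite mxE.
have v_vec c : B v (vec c) = 0.
  rewrite polar_sumr big1 // => i _; rewrite /h.
  by case: (split i) => j; rewrite ?(vD j).1 ?(vD j).2 mulr0.
have perpZ_gen x : (forall j, B x (z j) = 0) -> perp Z x.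
  move=> xz u /hZ[c ->]; rewrite polar_suml big1 // => j _.
  by rewrite polarC xz mulr0.
pose L := kermx C.
have vecL (c : 'rV_(n + n)) : (c <= L)%MS -> perp Z (vec c).
  by move=> /sub_kermxP cC; apply: perpZ_gen => j; rewrite vec_z cC mxE.
(* The vanishing of the polar form on Z^perp makes [L], the part of H orthogonal to [Z], totally
   isotropic. *)
have LGL : L *m (G *m L^T) = 0.
  apply/matrixP => i j; rewrite [RHS]mxE.
  rewrite -[RHS](B0 _ _ (vecL _ (row_sub i L)) (vecL _ (row_sub j L))).
  rewrite vec_vec -row_mul mulmxA mxE [RHS]mxE.
  by apply: eq_bigr => l _; rewrite !mxE.
have rGL : \rank (G *m L^T) = \rank L.
  by rewrite eqmxMfull ?mxrank_tr // row_full_unit.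
have rL : \rank L = (n + n - \rank C)%N by rewrite mxrank_ker.
(* Isotropy gives [\rank L <= n], hence [\rank C >= n], and [C] has [n] columns. So every linear
   form on [Z] comes from a vector of H, which yields [lift_perp]. *)
have rC : \rank C = n.
  by have := mulmx0_rank_max LGL; have := rank_leq_col C; rewrite rGL; lia.
have Cfull : row_full C by rewrite /row_full rC.
have lift_perp w : exists c, perp Z (w + vec c).
  have /submxP[c hc] := submx_full (\row_j - B w (z j)) Cfull.
  exists c; apply: perpZ_gen => j; rewrite polarDl vec_z -hc mxE; exact: addrN.
have [c hc] := lift_perp v.
(* Having half the dimension of H, [L] is its own orthogonal in H. *)
have cL : (c <= L)%MS.
  have sub : (L <= kermx (G *m L^T))%MS by apply/sub_kermxP.
  have: (kermx (G *m L^T) <= L)%MS.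
    rewrite -(mxrank_leqif_sup sub) mxrank_ker rGL rL rC; lia.
  apply: submx_trans; apply/sub_kermxP/rowP => j; rewrite mulmxA mxE [RHS]mxE.
  rewrite -[RHS](B0 _ _ hc (vecL _ (row_sub j L))).
  rewrite polarDl v_vec add0r vec_vec [RHS]mxE.
  by apply: eq_bigr => l _; rewrite !mxE.
have Zv : perp Z v.
  by rewrite -(addrK (vec c) v); apply: perpD => //; apply/perpN/vecL.
(* As [v] is orthogonal to H, correcting [w] into Z^perp does not change its pairing with [v]. *)
apply: vR => w; have [d hd] := lift_perp w.
by have := B0 _ _ Zv hd; rewrite polarDr v_vec addr0.
Qed.

(** * Propagation from two opposite points of a residue *)

Variable v0 : V.
Hypotheses (v0_defect : defect_space q e f v0) (v0_rad : ~ qf_radical q v0).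
Variable T : (V -> Prop) -> Prop.
Hypothesis closedT : dp_closed q n T.

(** This is goodness of [x] in the residue of [U]; it holds vacuously unless [adjoin U x] is totally
    singular. *)
Definition residue_covered U x := forall Z,
  TS q n Z -> (forall y, U y -> Z y) -> Z x -> T Z.

(** The space [adjoin U r] has dimension [n - 1], so it defines a line of the dual polar space.
    Adding [x] or [y] to it gives two distinct points of that line in [T], so [T] contains the whole
    line. *)
Lemma closed_through_two_lines k U r x y Z : k.+2 = n ->
  TS q k.+1 (adjoin U r) -> TS q k.+2 (adjoin (adjoin U r) x) ->
  TS q k.+2 (adjoin (adjoin U r) y) -> ~ adjoin (adjoin U r) x y ->
  residue_covered U x -> residue_covered U y ->
  TS q n Z -> (forall u, U u -> Z u) -> Z r -> T Z.
Proof.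
move=> kn XTS xTS yTS xy gx gy ZTS UZ Zr.
have sub z u : U u -> adjoin (adjoin U r) z u by move=> Uu; do 2!apply: adjoin_sub.
have lin z : TS q k.+2 (adjoin (adjoin U r) z) ->
    dpline q n (adjoin U r) (adjoin (adjoin U r) z).
  by rewrite kn => zTS; split=> // u; apply: adjoin_sub.
apply: (closedT (X := adjoin U r) _ (lin x xTS) (lin y yTS)).
- by rewrite -kn.
- by move=> E; apply: xy; rewrite E; apply: (adjoin_mem _ XTS.1).
- by apply: gx; rewrite -?kn //; [apply: sub | apply: (adjoin_mem _ XTS.1)].
- by apply: gy; rewrite -?kn //; [apply: sub | apply: (adjoin_mem _ XTS.1)].
- by split=> //; apply: (adjoin_le ZTS.1).
Qed.

(* Normalise [s], [t] in [Z] so that [s1 = s - p] and [t1 = t - p'] are orthogonal to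
   [p] and [p'] with [B s1 t1 = -1]. For [v] orthogonal to [U, p, p', s, t], the point
   [u v = s1 + q v *: t1 + v] is singular, hence good, and orthogonal to
   [r = s - q v *: t] in [Z]. Since [r] depends only on [q v], replacing [v] by its
   reflection [v'] in a nonorthogonal [w] gives a second line of [T] through [r],
   in every characteristic. *)
Lemma residue_rank2 k U p p' Z : k.+2 = n -> TS q k U ->
  q p = 0 -> q p' = 0 -> perp U p -> perp U p' -> B p p' = 1 ->
  (forall z, ~ U z -> q z = 0 -> perp U z -> B z p = 0 -> B z p' = 0 ->
     residue_covered U z) ->
  TS q n Z -> (forall x, U x -> Z x) -> T Z.
Proof.
move=> kn UTS qp qp' Up Up' pp' good ZTS UZ.
have perpZ z : Z z -> perp U z by move=> Zz u /UZ Zu; apply: (TS_polar ZTS).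
case: (classic (exists z, [/\ Z z, ~ U z, B z p = 0 & B z p' = 0])).
  move=> [z [Zz Uz zp zp']]; apply: (good z) => //; first exact: ZTS.2.
  exact: perpZ.
move=> nz.
(* One orthogonality condition on [Z], of dimension [k + 2], leaves a vector outside [U]; by [nz] it
   cannot be orthogonal to both [p] and [p']. *)
have [|s0 [Zs0 Us0 s0p]] :=
    subspace_extra_perp (fun _ : 'I_1 => p) UTS.1 ZTS.1; first by lia.
have [|t0 [Zt0 Ut0 t0p]] :=
    subspace_extra_perp (fun _ : 'I_1 => p') UTS.1 ZTS.1; first by lia.
have {s0p} s0p := s0p ord0; have {t0p} t0p := t0p ord0.
have s0p' : B s0 p' != 0.
  by apply/eqP => h; apply: nz; exists s0.
have t0p' : B t0 p != 0.
  by apply/eqP => h; apply: nz; exists t0.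
pose s := (B s0 p')^-1 *: s0; pose t := (B t0 p)^-1 *: t0.
have Zs : Z s by apply: (subspaceZ _ ZTS.1).
have Zt : Z t by apply: (subspaceZ _ ZTS.1).
have sp : B s p = 0 by rewrite polarZl s0p mulr0.
have sp' : B s p' = 1 by rewrite polarZl mulVf.
have tp' : B t p' = 0 by rewrite polarZl t0p mulr0.
have tp : B t p = 1 by rewrite polarZl mulVf.
have st : B s t = 0 by apply: (TS_polar ZTS).
have qs : q s = 0 by apply: ZTS.2.
have qt : q t = 0 by apply: ZTS.2.
clearbody s t.
have p'p : B p' p = 1 by rewrite polarC.
have [ss tt ps p's] : [/\ B s s = 0, B t t = 0, B p s = 0 & B p' s = 1].
  by split; rewrite ?polarxx0 // polarC.
have [pt p't ts pp p'p'] :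
    [/\ B p t = 1, B p' t = 0, B t s = 0, B p p = 0 & B p' p' = 0].
  by split; rewrite ?polarxx0 // polarC.
pose tab := (sp, sp', tp', tp, st, p'p, pp', ss, tt, ps, p's, pt, p't, ts, pp, p'p').
pose s1 := s - p; pose t1 := t - p'.
have [Us Ut] := (perpZ _ Zs, perpZ _ Zt).
have Us1 : perp U s1 by apply: perpD => //; apply: perpN.
have Ut1 : perp U t1 by apply: perpD => //; apply: perpN.
have s1t1 : B s1 t1 = -1 by rewrite /s1 /t1 !polarE !tab; ring.
have Up_notin : ~ U p.
  by apply: (perp_notin Up'); rewrite pp'; apply/eqP; rewrite oner_eq0.
have pTS : TS q k.+1 (adjoin U p) by apply: adjoin_TS.
have qs1 : q s1 = 0 by rewrite qfD qfN qs qp polarNr sp; ring.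
have qt1 : q t1 = 0 by rewrite qfD qfN qt qp' polarNr tp'; ring.
(* The vectors [v] and [w] are sought in the perp of this auxiliary maximal subspace. *)
have MTS : TS q n (adjoin (adjoin U p) s1).
  rewrite -kn; apply: adjoin_TS => //.
    apply: (@perp_notin _ _ t1).
      by apply: perp_adjoin; rewrite // /s1 /t1 !polarE !tab; ring.
    by rewrite s1t1; apply/eqP; rewrite oppr_eq0 oner_eq0.
  by apply: perp_adjoin; rewrite // /s1 /t1 !polarE !tab; ring.
set M := adjoin _ s1 in MTS.
have UM u : U u -> M u by move=> Uu; do 2!apply: adjoin_sub.
have pM : M p by apply/adjoin_sub/(adjoin_mem _ UTS.1).
have s1M : M s1 by apply: (adjoin_mem _ pTS.1).
(* Corrections from [M] change neither membership in M^perp nor polar values there, and they give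
   orthogonality to [p'] and [t1]. The signs come from [B p p' = 1] and [B s1 t1 = -1]. *)
pose proj x := x - B x p' *: p + B x t1 *: s1.
have projP x : perp M x -> [/\ perp M (proj x), B (proj x) p' = 0 & B (proj x) t1 = 0].
  move=> Mx; have [px s1x] := (Mx _ pM, Mx _ s1M); split.
  - apply: perpD; first apply: perpD => //.
      by apply/perpN/perp_scale => u /(TS_polar MTS)/(_ pM).
    by apply/perp_scale => u /(TS_polar MTS)/(_ s1M).
  - by rewrite /proj /s1 !polarE !tab; ring.
  - by rewrite /proj [B (_ + _) t1]polarDl [B (x - _) t1]polarDl polarNl !polarZl s1t1
       [B p t1]polarDr polarNr !tab; ring.
have [x [y [Mx My xy]]] := polar_nonzero_on_perp MTS v0_defect v0_rad.
have [Mv vp' vt1] := projP _ Mx; have [Mw wp' wt1] := projP _ My.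
have vw : B (proj x) (proj y) = B x y.
  rewrite {1}/proj [LHS]polarDl [B (x - _) _]polarDl polarNl !polarZl.
  rewrite (Mw _ pM) (Mw _ s1M) /proj [B x _]polarDr [B x (y - _)]polarDr.
  by rewrite polarNr !polarZr !(polarC x) (Mx _ pM) (Mx _ s1M); ring.
move: (proj x) (proj y) vw Mv Mw vp' wp' vt1 wt1 => {Mx My projP proj} v w vw.
move=> Mv Mw vp' wp' vt1 wt1; move: xy; rewrite -{}vw => vw {x y}.
(* A singular [z] in M^perp outside [M] would enlarge [M] beyond the Witt index. *)
have anisoM z z' : perp M z -> perp M z' -> B z z' <> 0 -> q z != 0.
  move=> Mz Mz' zz'; apply/eqP => qz.
  have := witt_index_le (adjoin_TS MTS (perp_notin Mz' zz') qz Mz).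
  by rewrite ltnn.
have qw : q w != 0 by apply: (anisoM w v); rewrite // polarC.
pose v' := v - (B v w / q w) *: w.
have Mv' : perp M v' by apply/perpD/perpN/perp_scale.
have qv' : q v' = q v.
  by rewrite qfD qfN qfZ polarNr polarZr; field.
have v't1 : B v' t1 = 0 by rewrite polarDl polarNl polarZl vt1 wt1; ring.
have v'p' : B v' p' = 0 by rewrite polarDl polarNl polarZl vp' wp'; ring.
pose r := s - q v *: t; pose u x := s1 + q v *: t1 + x.
have rp' : B r p' = 1 by rewrite !polarE !tab; ring.
have Zr : Z r by apply: (subspaceB ZTS.1) => //; apply: (subspaceZ _ ZTS.1).
have Ur : perp U r by apply: perpZ.
have XTS : TS q k.+1 (adjoin U r).
  apply: adjoin_TS => //; last exact: ZTS.2.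
  by apply: (perp_notin Up'); rewrite rp'; apply/eqP; rewrite oner_eq0.
have uP x : perp M x -> B x p' = 0 -> B x t1 = 0 -> q x = q v ->
    residue_covered U (u x) /\ TS q k.+2 (adjoin (adjoin U r) (u x)).
  move=> Mx xp' xt1 qx.
  have px := Mx _ pM; have s1x := Mx _ s1M.
  have xp : B x p = 0 by rewrite polarC.
  have t1x : B t1 x = 0 by rewrite polarC.
  have p'x : B p' x = 0 by rewrite polarC.
  have sx : B s x = 0 by rewrite -(subrK p s) polarDl s1x px addr0.
  have tx : B t x = 0 by rewrite -(subrK p' t) polarDl t1x p'x addr0.
  have Ux : perp U x by move=> z /UM /Mx.
  have Uu : perp U (u x) by apply: perpD => //; apply: perpD => //; apply: perp_scale.
  have qu : q (u x) = 0.
    rewrite qfD [q (s1 + _)]qfD qfZ qs1 qt1 qx [B (s1 + _) x]polarDl polarZr polarZl.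
    by rewrite s1t1 s1x t1x; ring.
  have up : B (u x) p = 0 by rewrite /u /s1 /t1 !polarE !tab xp; ring.
  have up' : B (u x) p' = 0 by rewrite /u /s1 /t1 !polarE !tab xp'; ring.
  have ut1 : B (u x) t1 = -1.
    by rewrite polarDl [B (s1 + _) _]polarDl polarZl s1t1 polarxx0 // xt1; ring.
  have nz1 : -1 <> 0 :> F by apply/eqP; rewrite oppr_eq0 oner_eq0.
  split.
    by apply: good => //; apply: (perp_notin Ut1); rewrite ut1.
  apply: adjoin_TS => //.
    (* Pairing with [p'] kills the coefficient of [r]; pairing with [t1] then excludes [U]. *)
    move=> [a Ua]; have a0 : a = 0.
      by have := Up' _ Ua; rewrite polarDl polarNl polarZl up' rp' mulr1 add0r => /eqP;
         rewrite oppr_eq0 => /eqP.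
    by move: Ua; rewrite a0 scale0r subr0; apply: (perp_notin Ut1); rewrite ut1.
  by apply: perp_adjoin; rewrite // /r /u /s1 /t1 !polarE !tab sx tx; ring.
have [gv TSv] := uP v Mv vp' vt1 erefl.
have [gv' TSv'] := uP v' Mv' v'p' v't1 qv'.
(* If the two points of the line coincided, they would contain [u v - u v'], a nonzero multiple of
   the nonsingular vector [w]. *)
apply: (closed_through_two_lines kn XTS TSv' TSv _ gv' gv ZTS UZ Zr) => uv.
have uv' := adjoin_mem (u v') XTS.1.
have := subspaceB TSv'.1 uv uv'.
have -> : u v - u v' = (B v w / q w) *: w.
  by rewrite /u /v' opprD addrACA subrr add0r opprD opprK addrA subrr add0r.
move/(subspaceZ_inv TSv'.1) => Nw.
have/eqP : q w = 0 by apply: TSv'.2; apply: Nw; rewrite mulf_neq0 ?invr_eq0 //; apply/eqP.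
exact/negP.
Qed.

(** Induction on the rank [m.+1] of the residue, with [U] varying: a point [z] orthogonal to [p] and
    [p'] is treated in the residue of [adjoin U z], where [p] and [p'] are still opposite and
    good. *)
Lemma opposite_residues_generate m k U p p' : (k + m.+1)%N = n -> TS q k U ->
  q p = 0 -> q p' = 0 -> perp U p -> perp U p' -> B p p' = 1 ->
  residue_covered U p -> residue_covered U p' ->
  forall Z, TS q n Z -> (forall x, U x -> Z x) -> T Z.
Proof.
elim: m => [|m IH] in k U *; move=> km UTS qp qp' Up Up' pp' gp gp' Z ZTS UZ.
  (* In rank 1, [U] defines a line, with distinct points [adjoin U p] and [adjoin U p']. *)
  have nz : (1 : F) <> 0 by apply/eqP; rewrite oner_eq0.
  have pTS : TS q n (adjoin U p).
    by rewrite -km addn1; apply: adjoin_TS => //; apply: (perp_notin Up'); rewrite pp'.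
  have p'TS : TS q n (adjoin U p').
    rewrite -km addn1; apply: adjoin_TS => //.
    by apply: (perp_notin Up); rewrite polarC pp'.
  have pp := adjoin_mem p UTS.1; have p'p' := adjoin_mem p' UTS.1.
  have UTS' : TS q n.-1 U by rewrite -km addn1.
  apply: (closedT UTS' (Z1 := adjoin U p) (Z2 := adjoin U p')) => //.
  - by split=> // x; apply: adjoin_sub.
  - by split=> // x; apply: adjoin_sub.
  - by move=> E; apply: nz; rewrite -pp' (TS_polar pTS) // E.
  - by apply: gp => // x; apply: adjoin_sub.
  - by apply: gp' => // x; apply: adjoin_sub.
have good z : ~ U z -> q z = 0 -> perp U z -> B z p = 0 -> B z p' = 0 ->
    residue_covered U z.
  move=> Uz qz Uz' zp zp' W WTS UW Wz.
  apply: (IH k.+1 (adjoin U z)) => //; first by rewrite addSnnS.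
  - exact: adjoin_TS.
  - exact: perp_adjoin.
  - exact: perp_adjoin.
  - by move=> Y YTS UY Yp; apply: gp => // x Ux; apply/UY/adjoin_sub.
  - by move=> Y YTS UY Yp; apply: gp' => // x Ux; apply/UY/adjoin_sub.
  - exact: (adjoin_le WTS.1).
case: m => [|m] in km {IH}.
  by apply: (@residue_rank2 k U p p') => //; rewrite -km addn2.
(* Now [Z] has dimension at least [k + 3], so two orthogonality conditions still leave a vector
   outside [U]. *)
have [|z [Zz Uz zp]] :=
    subspace_extra_perp (fun i : 'I_2 => if i == ord0 then p else p') UTS.1 ZTS.1.
  by lia.
apply: (good z) => //; first exact: ZTS.2.
- by move=> u /UZ Zu; apply: (TS_polar ZTS).
- exact: (zp ord0).
- exact: (zp ord_max).
Qed.

(** * The apartment of the hyperbolic basis *)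

Definition apartment_vec (b : 'I_n -> bool) i := if b i then e i else f i.

Lemma apartment_vec_singular b i : q (apartment_vec b i) = 0.
Proof. by rewrite /apartment_vec; case: (b i); case: (efP.1 i). Qed.

Lemma apartment_vec_polar b i j : B (apartment_vec b i) (apartment_vec b j) = 0.
Proof.
rewrite /apartment_vec; case: (eqVneq i j) => [<-|/negPf ij].
  by rewrite polarxx0 //; case: (b i); case: (efP.1 i).
by case: (b i); case: (b j); rewrite ?polar_ee ?polar_ff ?polar_ef ?polar_fe ?ij.
Qed.

(** Pairing with the opposite vector [d] of each hyperbolic pair reads off the coefficients. The
    injection [g] covers the members of a flag as well as the maximal subspaces. *)
Lemma apartment_TS b k (g : 'I_k -> 'I_n) : injective g ->
  TS q k (qf_span_of (fun i => apartment_vec b (g i))).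
Proof.
move=> g_inj; split.
  apply: span_subspace => c h i.
  pose d := if b (g i) then f (g i) else e (g i).
  have: B (\sum_(i < k) c i *: apartment_vec b (g i)) d = 0 by rewrite h polar0l.
  rewrite polar_suml (bigD1 i) //= big1 ?addr0 => [|j ji].
    by rewrite /apartment_vec /d; case: (b (g i));
       rewrite ?polar_ef ?polar_fe eqxx mulr1.
  have gji : (g j == g i) = false by rewrite (inj_eq g_inj) (negPf ji).
  by rewrite /apartment_vec /d; case: (b (g j)); case: (b (g i));
     rewrite ?polar_ef ?polar_fe ?polar_ee ?polar_ff ?gji ?mulr0.
move=> _ [c ->]; apply: qf_sum_singular => [i|i j].
  exact: apartment_vec_singular.
exact: apartment_vec_polar.
Qed.

Lemma apartment_generates :
  (forall b : {ffun 'I_n -> bool}, T (qf_span_of (apartment_vec b))) ->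
  forall Z, TS q n Z -> T Z.
Proof.
move=> Tb.
(* Here [m] counts the indices at which nothing is assumed of [Z]: [m = 0] is the apartment, [m = n]
   the goal. *)
have step m : (m <= n)%N -> forall (b : {ffun 'I_n -> bool}) Z, TS q n Z ->
    (forall i : 'I_n, (i < n - m)%N -> Z (apartment_vec b i)) -> T Z.
  elim: m => [|m IH] mn b Z ZTS hZ.
    have bTS : TS q n (qf_span_of (apartment_vec b)).
      exact: (@apartment_TS b n id (@inj_id _)).
    rewrite -(subspace_eq bTS.1 ZTS.1); first exact: Tb.
    move=> _ [c ->]; apply: (subspace_sum _ ZTS.1) => i.
    by apply: hZ; rewrite subn0 ltn_ord.
  have kn : (n - m.+1 < n)%N by lia.
  pose k := Ordinal kn.
  pose g (i : 'I_(n - m.+1)) : 'I_n := widen_ord (ltnW kn) i.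
  have g_inj : injective g by move=> i j /(congr1 val) /= /val_inj.
  have UTS := apartment_TS b g_inj.
  have perpU x : (forall i, B (apartment_vec b (g i)) x = 0) ->
      perp (qf_span_of (fun i => apartment_vec b (g i))) x.
    by move=> h _ [c ->]; rewrite polar_suml big1 // => i _; rewrite h mulr0.
  have gk i : (g i == k) = false.
    by apply/negbTE; rewrite -val_eqE /= neq_ltn ltn_ord.
  (* Both [e k] and [f k] are good: a maximal subspace through [U] and one of them contains the
     first [n - m] vectors of the frame with entry [k] of [b] set to [c], so [IH] applies. *)
  have residue c : residue_covered (qf_span_of (fun i => apartment_vec b (g i)))
      (if c then e k else f k).
    move=> Y YTS UY Yk.
    apply: (IH (ltnW mn) [ffun i => if i == k then c else b i] Y YTS) => i im.
    rewrite /apartment_vec ffunE; case: (eqVneq i k) => [->//|ik].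
    have ilt : (i < n - m.+1)%N.
      by move: ik; rewrite -val_eqE /= => ik; lia.
    have := UY _ (mem_span (fun i => apartment_vec b (g i)) (Ordinal ilt)).
    by rewrite /apartment_vec; have -> : g (Ordinal ilt) = i by apply: val_inj.
  apply: (@opposite_residues_generate m (n - m.+1) _ (e k) (f k) _ UTS) => //.
  - by rewrite subnK.
  - by case: (efP.1 k).
  - by case: (efP.1 k).
  - by apply: perpU => i; rewrite /apartment_vec; case: (b (g i));
       rewrite ?polar_ee ?polar_fe ?gk.
  - by apply: perpU => i; rewrite /apartment_vec; case: (b (g i));
       rewrite ?polar_ef ?polar_ff ?gk.
  - by rewrite polar_ef eqxx.
  - exact: (residue true).
  - exact: (residue false).
  - by move=> _ [c ->]; apply: (subspace_sum _ ZTS.1) => i; apply: hZ; exact: (ltn_ord i).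
move=> Z ZTS; apply: (step n (leqnn n) [ffun=> true] Z ZTS) => i.
by rewrite subnn.
Qed.

End Hyperbolic.
End Quadratic.

Theorem mainTheorem4 (F : fieldType) (V : lmodType F) (q : V -> F) (n : nat)
    (e f : 'I_n -> V) :
  is_quadratic_form q ->
  qf_nondegenerate q ->
  (2 <= n)%N ->
  hyperbolic_family q e f ->
  (* q is anisotropic on V_0 *)
  (forall v, defect_space q e f v -> v <> 0%R -> q v <> 0%R) ->
  (* d = dim V_0 > 0 *)
  (exists v, defect_space q e f v /\ v <> 0%R) ->
  (* char F = 2  ->  d_2 > 0, i.e. the qf_radical R is a proper subspace of V_0 *)
  ((2%:R)%R = 0%R :> F -> exists v, defect_space q e f v /\ ~ qf_radical q v) ->
  (* gr(Q_n) <= 2^n *)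
  exists (m : nat) (g : 'I_m -> (V -> Prop)),
    (m <= 2 ^ n)%N /\ (forall i, TS q n (g i)) /\
    dp_generates q n (fun Z => exists i, g i = Z).
Proof.
move=> qP _ _ efP aniso [v [vD v0]] char2.
(* If 2 is nonzero, any nonzero [v] in the defect space works, since its polar value with itself is
   [2 * q v]. *)
have [w [wD wR]] : exists w, defect_space q e f w /\ ~ qf_radical q w.
  have [/eqP/char2 //|two] := boolP (2%:R == 0 :> F).
  exists v; split=> // /(_ v); rewrite (polarxx qP) => /eqP.
  by rewrite mulf_eq0 (negPf two) => /eqP; apply: aniso.
exists #|{ffun 'I_n -> bool}|,
  (fun i => qf_span_of (apartment_vec e f (enum_val i : {ffun _ -> _}))).
split; first by rewrite card_ffun card_bool card_ord.
split=> [i|T gT closedT]; first exact: (apartment_TS qP efP _ (@inj_id _)).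
apply: (apartment_generates qP efP aniso wD wR closedT) => b.
by apply: gT; exists (enum_rank b); rewrite enum_rankK.
Qed.
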